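(* Let $\theta^0,\theta^\infty_1,\theta^\infty_2,\theta^\infty_3\in\mathbb{C}$ with $\theta^0+\theta^\infty_1+\theta^\infty_2+\theta^\infty_3=0$ and $\theta^0\neq0$. Let $q_1,p_1,q_2,p_2,u,v$ be holomorphic functions of $(t_1,t_2)$ on a domain of $\{t_1\neq t_2\}\subset\mathbb{C}^2$, with $u,v\neq0$. Put $G=\mathrm{diag}(1,u,v)$, $E_2=\mathrm{diag}(0,1,0)$, $E_3=\mathrm{diag}(0,0,1)$ and $$\hat A_\infty^{(-2)}=\mathrm{diag}(0,1,1),\quad \hat A_\infty^{(-1)}=\begin{pmatrix}0&-1&-1\\ -p_1q_1+\theta^\infty_2&-t_1&0\\ -p_2q_2+\theta^\infty_3&0&-t_2\end{pmatrix},\quad \hat A_0^{(0)}=\begin{pmatrix}1\\ p_1\\ p_2\end{pmatrix}(p_1q_1+p_2q_2+\theta^0,\,-q_1,\,-q_2),$$ $$\hat B_1=\begin{pmatrix}0&1&0\\ p_1q_1-\theta^\infty_2&0&\frac{p_1(q_1-q_2)-\theta^\infty_2}{t_1-t_2}\\ 0&\frac{p_2(q_2-q_1)-\theta^\infty_3}{t_1-t_2}&0\end{pmatrix},\quad \hat B_2=\begin{pmatrix}0&0&1\\ 0&0&\frac{p_1(q_1-q_2)-\theta^\infty_2}{t_2-t_1}\\ p_2q_2-\theta^\infty_3&\frac{p_2(q_2-q_1)-\theta^\infty_3}{t_2-t_1}&0\end{pmatrix}.$$ Consider the linear systems $\frac{\partial Y}{\partial x}=AY$, $\frac{\partial Y}{\partial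 t_i}=B^{(i)}Y$ $(i=1,2)$ with $$A=G^{-1}\left(\hat A_\infty^{(-2)}x+\hat A_\infty^{(-1)}+\frac{\hat A_0^{(0)}}{x}\right)G,\quad B^{(1)}=-E_2x+G^{-1}\hat B_1G,\quad B^{(2)}=-E_3x+G^{-1}\hat B_2G .$$ Then the compatibility conditions $\partial_{t_i}A-\partial_xB^{(i)}+[A,B^{(i)}]=O$ for $i=1,2$ (for all $x$) are equivalent to the Hamiltonian system $$\frac{\partial q_j}{\partial t_i}=\frac{\partial H_{t_i}}{\partial p_j},\qquad \frac{\partial p_j}{\partial t_i}=-\frac{\partial H_{t_i}}{\partial q_j}\qquad(i,j=1,2),$$ $$H_{t_1}=H_{\mathrm{IV}}(\theta^\infty_2,\theta^0;t_1;q_1,p_1)+p_2q_2p_1+\frac1{t_1-t_2}\{p_1(q_1-q_2)-\theta^\infty_2\}\{p_2(q_2-q_1)-\theta^\infty_3\},$$ $$H_{t_2}=H_{\mathrm{IV}}(\theta^\infty_3,\theta^0;t_2;q_2,p_2)+p_1q_1p_2+\frac1{t_2-t_1}\{p_1(q_1-q_2)-\theta^\infty_2\}\{p_2(q_2-q_1)-\theta^\infty_3\},$$ together with $$(t_1-t_2)\frac1u\frac{\partial u}{\partial t_1}=p_2(q_1-q_2)+(t_1-t_2)(q_1+t_1)+\theta^\infty_3,\quad (t_1-t_2)\frac1v\frac{\partial v}{\partial t_1}=p_1(q_2-q_1)+\theta^\infty_2,$$ $$(t_2-t_1)\frac1u\frac{\partial u}{\partial t_2}=p_2(q_1-q_2)+\theta^\infty_3,\quad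 (t_2-t_1)\frac1v\frac{\partial v}{\partial t_2}=p_1(q_2-q_1)+(t_2-t_1)(q_2+t_2)+\theta^\infty_2 .$$
   Context: $H_{\mathrm{IV}}(\alpha,\beta;t;q,p)=pq(p-q-t)+\beta p+\alpha q$ is the Hamiltonian of the fourth Painlevé equation. The Hamiltonians are those of the degenerate Garnier system $H_{\mathrm{Gar}}^{3+1+1}$, here attached to a rank-three linear system of spectral type $((1)(1))((1)),21$. *)

(* Defs.v *)
From HB Require Import structures.
From mathcomp Require Import all_boot all_order all_algebra.
From mathcomp Require Import all_classical all_reals all_analysis.
From mathcomp Require Import complex.

Set Implicit Arguments.
Unset Strict Implicit.
Unset Printing Implicit Defensive.

Import Order.TTheory GRing.Theory Num.Theory.
Import numFieldNormedType.Exports.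

Local Open Scope classical_set_scope.
Local Open Scope ring_scope.

(* The complex numbers, with their numFieldType structure: differentiability,
   'D_v and derive1 at this type are the complex (C-linear) notions. *)
Definition CC (R : realType) : numFieldType := R[i].

Definition domain (R : realType) (D : set (CC R * CC R)) : Prop :=
  [/\ D !=set0, open D & connected D].

Definition holomorphic_on (R : realType) (D : set (CC R * CC R))
    (f : CC R * CC R -> CC R) : Prop :=
  forall t, D t -> differentiable f t.

(* 'D_dt1 and 'D_dt2 are the partial derivatives in t_1 and t_2. *)
Definition dt1 {R : realType} : CC R * CC R := (1, 0).
Definition dt2 {R : realType} : CC R * CC R := (0, 1).

Section Matrices.
Context {R : realType}.
Local Notation C := (CC R).

Definition mx3 (rows : seq (seq C)) : 'M[C]_3 :=
  \matrix_(i < 3, j < 3) (nth [::] rows i)`_j.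

Definition diag3 (a b c : C) : 'M[C]_3 :=
  diag_mx (\row_(j < 3) [:: a; b; c]`_j).

Definition gaugeG (u v : C) : 'M[C]_3 := diag3 1 u v.

Definition Ahat_inf2 : 'M[C]_3 := diag3 0 1 1.

Definition Ahat_inf1 (th2 th3 t1 t2 q1 p1 q2 p2 : C) : 'M[C]_3 :=
  mx3 [:: [::                 0; -1 ; -1 ];
          [:: - p1 * q1 + th2; - t1;   0 ];
          [:: - p2 * q2 + th3;    0; - t2]].

Definition Ahat_0 (th0 q1 p1 q2 p2 : C) : 'M[C]_3 :=
  (\col_(i < 3) [:: 1; p1; p2]`_i) *m
  (\row_(j < 3) [:: p1 * q1 + p2 * q2 + th0; - q1; - q2]`_j).

Definition Bhat1 (th2 th3 t1 t2 q1 p1 q2 p2 : C) : 'M[C]_3 :=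
  mx3 [:: [:: 0; 1; 0];
          [:: p1 * q1 - th2; 0; (p1 * (q1 - q2) - th2) / (t1 - t2)];
          [:: 0; (p2 * (q2 - q1) - th3) / (t1 - t2); 0]].

Definition Bhat2 (th2 th3 t1 t2 q1 p1 q2 p2 : C) : 'M[C]_3 :=
  mx3 [:: [:: 0; 0; 1];
          [:: 0; 0; (p1 * (q1 - q2) - th2) / (t2 - t1)];
          [:: p2 * q2 - th3; (p2 * (q2 - q1) - th3) / (t2 - t1); 0]].

Definition Amx (th0 th2 th3 : C) (q1 p1 q2 p2 u v : C * C -> C)
    (x : C) (t : C * C) : 'M[C]_3 :=
  let G := gaugeG (u t) (v t) in
  invmx G *m
  (x *: Ahat_inf2
   + Ahat_inf1 th2 th3 t.1 t.2 (q1 t) (p1 t) (q2 t) (p2 t)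
   + x^-1 *: Ahat_0 th0 (q1 t) (p1 t) (q2 t) (p2 t)) *m G.

Definition Bmx1 (th2 th3 : C) (q1 p1 q2 p2 u v : C * C -> C)
    (x : C) (t : C * C) : 'M[C]_3 :=
  let G := gaugeG (u t) (v t) in
  - (x *: diag3 0 1 0)
  + invmx G *m Bhat1 th2 th3 t.1 t.2 (q1 t) (p1 t) (q2 t) (p2 t) *m G.

Definition Bmx2 (th2 th3 : C) (q1 p1 q2 p2 u v : C * C -> C)
    (x : C) (t : C * C) : 'M[C]_3 :=
  let G := gaugeG (u t) (v t) in
  - (x *: diag3 0 0 1)
  + invmx G *m Bhat2 th2 th3 t.1 t.2 (q1 t) (p1 t) (q2 t) (p2 t) *m G.

(* Compatibility at (x, t) of dY/dx = A Y with dY/dt_i = B Y, where e is the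
   direction of t_i. *)
Definition compatible_at (e : C * C) (A B : C -> C * C -> 'M[C]_3)
    (x : C) (t : C * C) : Prop :=
  'D_e (fun s => A x s) t - derive1 (fun y => B y t) x
  + (A x t *m B x t - B x t *m A x t) = 0.

End Matrices.

Section Hamiltonians.
Context {R : realType}.
Local Notation C := (CC R).

Definition HIV (alpha beta t q p : C) : C :=
  p * q * (p - q - t) + beta * p + alpha * q.

Definition Ht1 (th0 th2 th3 t1 t2 q1 p1 q2 p2 : C) : C :=
  HIV th2 th0 t1 q1 p1 + p2 * q2 * p1
  + (t1 - t2)^-1 * ((p1 * (q1 - q2) - th2) * (p2 * (q2 - q1) - th3)).

Definition Ht2 (th0 th2 th3 t1 t2 q1 p1 q2 p2 : C) : C :=
  HIV th3 th0 t2 q2 p2 + p1 * q1 * p2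
  + (t2 - t1)^-1 * ((p1 * (q1 - q2) - th2) * (p2 * (q2 - q1) - th3)).

(* Hamilton's equations at t in the time direction e; H takes its arguments
   in the order t1 t2 q1 p1 q2 p2. *)
Definition hamilton_at (e : C * C) (H : C -> C -> C -> C -> C -> C -> C)
    (q1 p1 q2 p2 : C * C -> C) (t : C * C) : Prop :=
  let h := H t.1 t.2 in
  [/\ 'D_e q1 t = derive1 (fun y => h (q1 t) y (q2 t) (p2 t)) (p1 t),
      'D_e q2 t = derive1 (fun y => h (q1 t) (p1 t) (q2 t) y) (p2 t),
      'D_e p1 t = - derive1 (fun y => h y (p1 t) (q2 t) (p2 t)) (q1 t) &
      'D_e p2 t = - derive1 (fun y => h (q1 t) (p1 t) y (p2 t)) (q2 t)].

End Hamiltonians.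

(* Main.v *)
Require Import Defs.
From HB Require Import structures.
From mathcomp Require Import all_boot all_order all_algebra.
From mathcomp Require Import all_classical all_reals all_analysis.
From mathcomp Require Import complex ring.

Import Order.TTheory GRing.Theory Num.Theory.
Import numFieldNormedType.Exports.

Local Open Scope classical_set_scope.
Local Open Scope ring_scope.

(** Conjugation by the diagonal matrix G turns each compatibility condition into
a matrix equation without u and v, except through the diagonal matrix W of the
logarithmic derivatives (0, u'/u, v'/v):
  dA/dt + E + [A, W + B - x E] = 0,
where A, B are now the ungauged matrices and E is E_2 or E_3
([compatible_at_curvature]).  The left-hand side is a Laurent polynomial in x
([curvature_laurent]), so the equation says that its coefficients vanish
([laurent_eq0]).

For the first time ([curvature_flow1]), the coefficient of x vanishes
identically.  In the constant coefficient, the entries (1,2) and (1,3) give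
exactly the equations for u'/u and v'/v.  The residue at x = 0 is the key point.
The residue matrix of A is r l with r the column (1, p_1, p_2) and l a row, and
the coefficient of 1/x takes the form eps l + r delta, where the first entry of
eps is 0.  Its first row is delta, so delta = 0, and then eps l = 0.  The row l
cannot vanish, because q_1 = q_2 = 0 leaves theta^0 as its first entry; hence
eps = 0 ([rank_one_eq0]).  This is where theta^0 <> 0 enters: without it, p_1
and p_2 would not be determined where l vanishes.  The last two entries of eps
and of delta are the equations for the derivatives of p_1, p_2 and q_1, q_2, and
every remaining entry of the curvature is a consequence of these equations.

The second time needs no new computation: exchanging the indices 1 and 2 (and
the corresponding last two coordinates of the linear system) exchanges the two
flows ([curvature_flow2], [Ht2_swap]). *)

(** * Derivatives over a numeric field *)

Section Derivatives.
Set Implicit Arguments.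
Unset Strict Implicit.
Context {F : numFieldType} {V : normedModType F}.
Implicit Types (f g : V -> F) (t e : V).

Lemma is_derive_scalel (W : normedModType F) (w : W) f t e df :
  is_derive t e f df -> is_derive t e (fun s => f s *: w) (df *: w).
Proof.
move=> [/cvg_ex[l fl] fe].
have dfl : df = l by rewrite -fe; exact/cvg_lim.
suff fw : (fun h : F => h^-1 *: (((fun s => f s *: w) \o shift t) (h *: e)
    - f t *: w)) @ 0^' --> df *: w.
  by apply: DeriveDef; [apply/cvg_ex; exists (df *: w)|exact: cvg_lim fw].
under eq_cvg do rewrite /= -scalerBl scalerA.
by apply: cvgZr_tmp; rewrite dfl.
Qed.

(** By linearity: a matrix is the combination of the constant matrices
[delta_mx i j] with its entries as coefficients. *)
Lemma is_derive_mx m n (M : V -> 'M[F]_(m, n)) t e (dM : 'M[F]_(m, n)) :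
  (forall i j, is_derive t e (fun s => M s i j) (dM i j)) ->
  is_derive t e M dM.
Proof.
move=> dMij; rewrite [dM]matrix_sum_delta.
rewrite (_ : M = \sum_i \sum_j (fun s => M s i j *: delta_mx i j)).
  do 2 apply: is_derive_sum => ?.
  exact: is_derive_scalel.
apply/funext => s; rewrite fct_sumE [LHS]matrix_sum_delta.
by apply: eq_bigr => i _; rewrite fct_sumE.
Qed.

Lemma is_derive_matrix m n (a : V -> 'I_m -> 'I_n -> F) t e da :
  (forall i j, is_derive t e (fun s => a s i j) (da i j)) ->
  is_derive t e (fun s => \matrix_(i, j) a s i j) (\matrix_(i, j) da i j).
Proof.
move=> ad; apply: is_derive_mx => i j; rewrite mxE.
by rewrite (_ : (fun s => _) = (fun s => a s i j)) //;
  apply/funext => s; rewrite mxE.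
Qed.

Lemma is_derive_coord m n (M : V -> 'M[F]_(m, n)) t e (dM : 'M[F]_(m, n)) i j :
  is_derive t e M dM -> is_derive t e (fun s => M s i j) (dM i j).
Proof.
move=> [/cvg_ex[l Ml] Me].
have dMl : dM = l by rewrite -Me; exact/cvg_lim.
suff Mij : (fun h : F => h^-1 *: (((fun s => M s i j) \o shift t) (h *: e)
    - M t i j)) @ 0^' --> dM i j.
  by apply: DeriveDef; [apply/cvg_ex; exists (dM i j)|exact: cvg_lim Mij].
have := cvg_comp _ _ Ml (@coord_continuous F m n i j l).
rewrite -dMl; apply: cvg_trans; apply: near_eq_cvg; near=> h.
by rewrite /= !mxE.
Unshelve. all: by end_near. Qed.

Lemma is_derive_mulmx m n p (M : V -> 'M[F]_(m, n)) (N : V -> 'M[F]_(n, p))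
    t e dM dN :
  is_derive t e M dM -> is_derive t e N dN ->
  is_derive t e (fun s => M s *m N s) (dM *m N t + M t *m dN).
Proof.
move=> Md Nd; apply: is_derive_mx => i j.
rewrite (_ : (fun s => _) =
  \sum_k ((fun s => M s i k) * (fun s => N s k j))); last first.
  by apply/funext => s; rewrite fct_sumE mxE.
rewrite !mxE -big_split; apply: is_derive_sum => k.
have Mk := is_derive_coord i k Md; have Nk := is_derive_coord k j Nd.
apply: is_derive_eq (is_deriveM Mk Nk) _.
by rewrite addrC /GRing.scale /= [N t k j * _]mulrC.
Qed.

(** Serves the coordinate functions of a product, whose increments are exactly
linear. *)
Lemma is_derive_affine f t e c :
  (forall h, f (h *: e + t) = f t + h * c) -> is_derive t e f c.
Proof.
move=> fE.
suff fc : (fun h : F => h^-1 *: ((f \o shift t) (h *: e) - f t)) @ 0^' --> c.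
  by apply: DeriveDef; [apply/cvg_ex; exists c|exact: cvg_lim fc].
apply: (@cvg_trans _ (cst c @ (0^' : set_system F))); last exact: cvg_cst.
apply: near_eq_cvg; near=> h.
rewrite /= fE addrC addKr /GRing.scale /= mulrA mulVf ?mul1r //.
by near: h; exact: nbhs_dnbhs_neq.
Unshelve. all: by end_near. Qed.

Lemma is_deriveDf f g t e df dg : is_derive t e f df -> is_derive t e g dg ->
  is_derive t e (fun s => f s + g s) (df + dg).
Proof. exact: is_deriveD. Qed.

Lemma is_deriveNf f t e df : is_derive t e f df ->
  is_derive t e (fun s => - f s) (- df).
Proof. exact: is_deriveN. Qed.

Lemma is_deriveMf f g t e df dg : is_derive t e f df -> is_derive t e g dg ->
  is_derive t e (fun s => f s * g s) (df * g t + f t * dg).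
Proof.
move=> fd gd; apply: is_derive_eq (is_deriveM fd gd) _.
by rewrite addrC /GRing.scale /= [g t * _]mulrC.
Qed.

Lemma is_deriveVf f t e df : f t != 0 -> is_derive t e f df ->
  is_derive t e (fun s => (f s)^-1) (- (f t) ^- 2 * df).
Proof.
move=> ft0 [fd <-]; apply: DeriveDef; first exact: derivableV.
exact: deriveV.
Qed.

Unset Implicit Arguments.
Set Strict Implicit.
End Derivatives.

(** Each Hamiltonian is at most quadratic in each of its four canonical
variables, so this is the only differentiation rule that the partial derivatives
need. *)
Lemma derive1_quadratic (F : numFieldType) (f : F -> F) (c1 c2 x : F) :
  (forall y, f y = f 0 + c1 * y + c2 * y ^+ 2) ->
  derive1 f x = c1 + c2 * x *+ 2.
Proof.
rewrite derive1E => fE; move: (f 0) fE => c0 fE.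
rewrite (_ : f = fun y => c0 + y * (c1 + y * c2)); last first.
  by apply/funext => y; rewrite fE; ring.
have dy : is_derive x (1 : F) (fun y => y) 1 by exact: is_derive_id.
have dc (c : F) : is_derive x (1 : F) (fun=> c) 0 by exact: is_derive_cst.
have [_ ->] := is_deriveDf (dc c0)
  (is_deriveMf dy (is_deriveDf (dc c1) (is_deriveMf dy (dc c2)))).
ring.
Qed.
Arguments derive1_quadratic {F f} c1 c2 {x}.

(** * Explicit 3 x 3 matrices, Laurent polynomials, rank-one residues *)

Section Algebra.
Context {R : realType}.
Local Notation C := (CC R).

(** All matrix identities below are reduced to explicit 3 x 3 arrays with
[mx3E] and then checked entry by entry with [mx3P]. *)
Lemma mx3P (a b c d e f g h i a' b' c' d' e' f' g' h' i' : C) :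
  a = a' -> b = b' -> c = c' -> d = d' -> e = e' -> f = f' ->
  g = g' -> h = h' -> i = i' ->
  mx3 [:: [:: a; b; c]; [:: d; e; f]; [:: g; h; i]] =
  mx3 [:: [:: a'; b'; c']; [:: d'; e'; f']; [:: g'; h'; i']].
Proof. by do 9 move=> ->. Qed.

Lemma mx3M (a b c d e f g h i a' b' c' d' e' f' g' h' i' : C) :
  mx3 [:: [:: a; b; c]; [:: d; e; f]; [:: g; h; i]] *m
  mx3 [:: [:: a'; b'; c']; [:: d'; e'; f']; [:: g'; h'; i']] =
  mx3 [:: [:: a * a' + b * d' + c * g'; a * b' + b * e' + c * h';
              a * c' + b * f' + c * i'];
          [:: d * a' + e * d' + f * g'; d * b' + e * e' + f * h';
              d * c' + e * f' + f * i'];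
          [:: g * a' + h * d' + i * g'; g * b' + h * e' + i * h';
              g * c' + h * f' + i * i']].
Proof.
apply/matrixP => -[[|[|[|//]]] ?] [[|[|[|//]]] ?];
  by rewrite !mxE !big_ord_recl big_ord0 !mxE /= addr0 addrA.
Qed.

Lemma mx3D (a b c d e f g h i a' b' c' d' e' f' g' h' i' : C) :
  mx3 [:: [:: a; b; c]; [:: d; e; f]; [:: g; h; i]] +
  mx3 [:: [:: a'; b'; c']; [:: d'; e'; f']; [:: g'; h'; i']] =
  mx3 [:: [:: a + a'; b + b'; c + c']; [:: d + d'; e + e'; f + f'];
          [:: g + g'; h + h'; i + i']].
Proof.
by apply/matrixP => -[[|[|[|//]]] ?] [[|[|[|//]]] ?]; rewrite !mxE.
Qed.

Lemma mx3N (a b c d e f g h i : C) :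
  - mx3 [:: [:: a; b; c]; [:: d; e; f]; [:: g; h; i]] =
  mx3 [:: [:: - a; - b; - c]; [:: - d; - e; - f]; [:: - g; - h; - i]].
Proof.
by apply/matrixP => -[[|[|[|//]]] ?] [[|[|[|//]]] ?]; rewrite !mxE.
Qed.

Lemma diag3E (a b c : C) :
  diag3 a b c = mx3 [:: [:: a; 0; 0]; [:: 0; b; 0]; [:: 0; 0; c]].
Proof.
by apply/matrixP => -[[|[|[|//]]] ?] [[|[|[|//]]] ?]; rewrite !mxE /= ?mulr1n ?mulr0n.
Qed.

Lemma diag3_1 : diag3 1 1 1 = 1%:M :> 'M[C]_3.
Proof.
by apply/matrixP => -[[|[|[|//]]] ?] [[|[|[|//]]] ?];
  rewrite !mxE /= ?mulr1n ?mulr0n.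
Qed.

Lemma mx3_0 : mx3 [:: [:: 0; 0; 0]; [:: 0; 0; 0]; [:: 0; 0; 0]] = 0 :> 'M[C]_3.
Proof.
by apply/matrixP => -[[|[|[|//]]] ?] [[|[|[|//]]] ?]; rewrite !mxE.
Qed.

Lemma outer3E (a b c a' b' c' : C) :
  (\col_(i < 3) [:: a; b; c]`_i) *m (\row_(j < 3) [:: a'; b'; c']`_j) =
  mx3 [:: [:: a * a'; a * b'; a * c']; [:: b * a'; b * b'; b * c'];
          [:: c * a'; c * b'; c * c']].
Proof.
apply/matrixP => -[[|[|[|//]]] ?] [[|[|[|//]]] ?];
  by rewrite !mxE big_ord1 !mxE.
Qed.

Definition mx3E := (diag3E, outer3E, mx3M, mx3N, mx3D).

(** The values 1, -1 and 2 of x suffice to separate the three coefficients. *)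
Lemma laurent_eq0 n (P Q S : 'M[C]_n) :
  (forall x : C, x != 0 -> x *: P + Q + x^-1 *: S = 0) <->
  [/\ P = 0, Q = 0 & S = 0].
Proof.
split=> [PQS|[-> -> ->] x _]; last by rewrite !scaler0 !addr0.
have n2 : (2%:R : C) != 0 by rewrite pnatr_eq0.
have n3 : (3%:R : C) != 0 by rewrite pnatr_eq0.
have coef i j (x : C) : x != 0 -> x * P i j + Q i j + x^-1 * S i j = 0.
  by move=> /PQS/matrixP/(_ i j); rewrite !mxE.
have PQSij i j : [/\ P i j = 0, Q i j = 0 & S i j = 0].
  have e1 := coef i j 1 (oner_neq0 _).
  have e2 : - 1 * P i j + Q i j + (- 1)^-1 * S i j = 0.
    by apply: coef; rewrite oppr_eq0 oner_neq0.
  have e3 := coef i j 2%:R n2.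
  rewrite invr1 !mul1r in e1; rewrite invrN1 !mulN1r in e2.
  have Q0 : Q i j = 0.
    rewrite -[Q i j](mulKf n2).
    rewrite (_ : _ * Q i j = (P i j + Q i j + S i j)
      + (- P i j + Q i j - S i j)); last by ring.
    by rewrite e1 e2 addr0 mulr0.
  rewrite Q0 addr0 in e1; rewrite Q0 addr0 in e3.
  have SP : S i j = - P i j by apply/eqP; rewrite -addr_eq0 addrC e1.
  have P0 : P i j = 0.
    rewrite -[P i j](mulKf n3).
    rewrite (_ : _ * P i j = 2%:R * (2%:R * P i j + 2%:R^-1 * S i j)); last first.
      by rewrite SP; field.
    by rewrite e3 !mulr0.
  by rewrite SP P0 oppr0.
by split; apply/matrixP => i j; rewrite mxE; have [] := PQSij i j.
Qed.

(** The first row of eps l + r delta is delta, because eps starts with 0 and r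
with 1; once delta vanishes, a nonzero l forces eps to vanish. *)
Lemma rank_one_eq0 n (r eps : 'cV[C]_n.+1) (l delta : 'rV[C]_n.+1) :
  r ord0 0 = 1 -> eps ord0 0 = 0 -> l != 0 ->
  eps *m l + r *m delta = 0 <-> eps = 0 /\ delta = 0.
Proof.
move=> r0 eps0 /eqP ln0; split=> [E|[-> ->]]; last by rewrite mul0mx mulmx0 addr0.
have entry i j : eps i 0 * l 0 j + r i 0 * delta 0 j = 0.
  by have /matrixP/(_ i j) := E; rewrite !mxE !big_ord1.
have d0 : delta = 0.
  apply/rowP => j; have := entry ord0 j.
  by rewrite eps0 r0 mul0r add0r mul1r mxE.
split=> //; apply/colP => i; rewrite mxE; apply/eqP; apply: contra_notT ln0 => ei.
apply/rowP => j; rewrite mxE; apply: (mulfI ei).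
by have := entry i j; rewrite d0 mxE !mulr0 addr0.
Qed.

End Algebra.
Arguments rank_one_eq0 {R n r eps l} delta.

(** * The curvature and the first flow *)

Section Flow.
Context {R : realType}.
Local Notation C := (CC R).

(** The derivative of [Ahat_inf1] along a direction in which t_1, t_2 have
derivatives tau1, tau2 and q_1, ..., p_2 have derivatives dq1, ..., dp2. *)
Definition dAhat_inf1 (tau1 tau2 q1 p1 q2 p2 dq1 dp1 dq2 dp2 : C) : 'M[C]_3 :=
  mx3 [:: [:: 0; 0; 0];
          [:: - (dp1 * q1 + p1 * dq1); - tau1; 0];
          [:: - (dp2 * q2 + p2 * dq2); 0; - tau2]].

Definition dAhat_0 (th0 q1 p1 q2 p2 dq1 dp1 dq2 dp2 : C) : 'M[C]_3 :=
  (\col_(i < 3) [:: 0; dp1; dp2]`_i) *m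
  (\row_(j < 3) [:: p1 * q1 + p2 * q2 + th0; - q1; - q2]`_j)
  + (\col_(i < 3) [:: 1; p1; p2]`_i) *m
  (\row_(j < 3) [:: dp1 * q1 + p1 * dq1 + (dp2 * q2 + p2 * dq2);
                    - dq1; - dq2]`_j).

(** The compatibility condition after conjugation by G: dAi1 and dA0 are the
derivatives of Ai1 and A0 in the time considered, M is W + B and the term E is
minus the x-derivative of M - x E. *)
Definition curvature (Ai2 Ai1 A0 dAi1 dA0 M E : 'M[C]_3) (x : C) : 'M[C]_3 :=
  let A := x *: Ai2 + Ai1 + x^-1 *: A0 in
  let B := M - x *: E in
  dAi1 + x^-1 *: dA0 + E + (A *m B - B *m A).

(** The coefficient of x^2 is the commutator of Ai2 and E; in the application both
are diagonal. *)
Lemma curvature_laurent (Ai2 Ai1 A0 dAi1 dA0 M E : 'M[C]_3) (x : C) :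
  x != 0 -> Ai2 *m E = E *m Ai2 ->
  curvature Ai2 Ai1 A0 dAi1 dA0 M E x =
  x *: (Ai2 *m M - M *m Ai2 - (Ai1 *m E - E *m Ai1))
  + (dAi1 + E + (Ai1 *m M - M *m Ai1) - (A0 *m E - E *m A0))
  + x^-1 *: (dA0 + (A0 *m M - M *m A0)).
Proof.
move=> x0 Ai2E; rewrite /curvature !(mulmxDl, mulmxDr, mulmxN, mulNmx).
rewrite -!(scalemxAl, scalemxAr) Ai2E.
(* The identity is linear in the matrix products; with each of them a
   variable, the check on an entry is a short scalar identity. *)
move: (Ai2 *m M) (M *m Ai2) (Ai1 *m E) (E *m Ai1) (Ai1 *m M) (M *m Ai1).
move: (A0 *m E) (E *m A0) (A0 *m M) (M *m A0) (E *m Ai2).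
move=> A0E EA0 A0M MA0 EAi2 Ai2M MAi2 Ai1E EAi1 Ai1M MAi1.
rewrite !scalerA !(mulrV, mulVr) ?unitfE // !scale1r.
apply/matrixP => i j; by rewrite !mxE; ring.
Qed.

(** Hamilton's equations for [Ht1] together with the equations for the gauge, with
the partial derivatives worked out; a and b stand for u'/u and v'/v, and f, g are
the two off-diagonal entries of [Bhat1] with a denominator.  The same predicate
with the indices exchanged describes the second flow. *)
Definition flow1 (th0 th2 th3 t1 t2 q1 p1 q2 p2 dq1 dp1 dq2 dp2 a b : C) :=
  let f := (p1 * (q1 - q2) - th2) / (t1 - t2) in
  let g := (p2 * (q2 - q1) - th3) / (t1 - t2) in
  [/\ dq1 = p1 * q1 *+ 2 - q1 ^+ 2 - t1 * q1 + th0 + p2 * q2 + g * (q1 - q2),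
      dq2 = p1 * q2 + f * (q2 - q1),
      dp1 = p1 * q1 *+ 2 + t1 * p1 - p1 ^+ 2 - th2 - p1 * g + p2 * f,
      dp2 = p1 * g - p2 * f - p1 * p2 &
      a = q1 + t1 - g /\ b = - f].

(** Equations for a and b come from the constant term, the four others from the
residue at x = 0. *)
Lemma curvature_flow1 (th0 th2 th3 t1 t2 q1 p1 q2 p2 dq1 dp1 dq2 dp2 a b : C) :
  th0 != 0 -> t1 != t2 ->
  (forall x, x != 0 ->
     curvature Ahat_inf2 (Ahat_inf1 th2 th3 t1 t2 q1 p1 q2 p2)
       (Ahat_0 th0 q1 p1 q2 p2)
       (dAhat_inf1 1 0 q1 p1 q2 p2 dq1 dp1 dq2 dp2)
       (dAhat_0 th0 q1 p1 q2 p2 dq1 dp1 dq2 dp2)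
       (diag3 0 a b + Bhat1 th2 th3 t1 t2 q1 p1 q2 p2) (diag3 0 1 0) x = 0)
  <-> flow1 th0 th2 th3 t1 t2 q1 p1 q2 p2 dq1 dp1 dq2 dp2 a b.
Proof.
move=> th00; rewrite -subr_eq0 => t12.
set M := _ + Bhat1 _ _ _ _ _ _ _ _; set E := diag3 0 1 0.
have Ai2E : Ahat_inf2 *m E = E *m Ahat_inf2.
  by rewrite /Ahat_inf2 /E !mx3E; apply: mx3P; ring.
pose f := (p1 * (q1 - q2) - th2) / (t1 - t2).
pose g := (p2 * (q2 - q1) - th3) / (t1 - t2).
have ME : M = mx3 [:: [:: 0; 1; 0]; [:: p1 * q1 - th2; a; f]; [:: 0; g; b]].
  by rewrite /M /Bhat1 mx3E mx3D; apply: mx3P; rewrite ?addr0 ?add0r.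
have fE : p1 * (q1 - q2) - th2 = f * (t1 - t2) by rewrite mulfVK.
have gE : p2 * (q2 - q1) - th3 = g * (t1 - t2) by rewrite mulfVK.
(* With f and g as independent variables in place of theta_2 and theta_3, all
   identities below are polynomial. *)
have th2E : th2 = p1 * (q1 - q2) - f * (t1 - t2) by rewrite -fE; ring.
have th3E : th3 = p2 * (q2 - q1) - g * (t1 - t2) by rewrite -gE; ring.
set Ai1 := Ahat_inf1 _ _ _ _ _ _ _ _; set A0 := Ahat_0 _ _ _ _ _.
set dAi1 := dAhat_inf1 _ _ _ _ _ _ _ _ _ _.
set dA0 := dAhat_0 _ _ _ _ _ _ _ _ _.
have linear_term : Ahat_inf2 *m M - M *m Ahat_inf2 - (Ai1 *m E - E *m Ai1) = 0.
  by rewrite /Ahat_inf2 /Ai1 /E ME !mx3E -mx3_0; apply: mx3P; ring.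
pose r : 'cV[C]_3 := \col_(i < 3) [:: 1; p1; p2]`_i.
pose l : 'rV[C]_3 := \row_(j < 3) [:: p1 * q1 + p2 * q2 + th0; - q1; - q2]`_j.
(* eps is dr - M r + p1 r and delta is dl + l M - p1 l.  The multiple p1 of
   the product r l cancels in the sum; it makes the first entry of eps vanish,
   since M r starts with p1. *)
pose eps : 'cV[C]_3 := \col_(i < 3) [:: 0;
  dp1 - (p1 * q1 - th2 + a * p1 + f * p2) + p1 ^+ 2;
  dp2 - (g * p1 + b * p2) + p1 * p2]`_i.
pose delta : 'rV[C]_3 := \row_(j < 3) [::
  dp1 * q1 + p1 * dq1 + (dp2 * q2 + p2 * dq2)
    - q1 * (p1 * q1 - th2) - p1 * (p1 * q1 + p2 * q2 + th0);
  - dq1 + (p1 * q1 + p2 * q2 + th0) - q1 * a - q2 * g + p1 * q1;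
  - dq2 - q1 * f - q2 * b + p1 * q2]`_j.
have residue : dA0 + (A0 *m M - M *m A0) = eps *m l + r *m delta.
  by rewrite /dA0 /dAhat_0 /A0 /Ahat_0 ME !mx3E; apply: mx3P; ring.
have l_neq0 : l != 0.
  apply: contraNneq th00 => /rowP l0.
  have := l0 0; have := l0 1; have := l0 (1 + 1); rewrite !mxE /=.
  move=> /eqP; rewrite oppr_eq0 => /eqP -> /eqP; rewrite oppr_eq0 => /eqP ->.
  by rewrite !mulr0 !add0r => ->.
have -> : (forall x, x != 0 -> curvature Ahat_inf2 Ai1 A0 dAi1 dA0 M E x = 0) <->
    (dAi1 + E + (Ai1 *m M - M *m Ai1) - (A0 *m E - E *m A0) = 0 /\
     eps *m l + r *m delta = 0).
  rewrite -residue; split=> [K|[Q0 S0] x x0].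
    suff /laurent_eq0[_ -> ->] : forall x : C, x != 0 ->
        x *: (Ahat_inf2 *m M - M *m Ahat_inf2 - (Ai1 *m E - E *m Ai1))
        + (dAi1 + E + (Ai1 *m M - M *m Ai1) - (A0 *m E - E *m A0))
        + x^-1 *: (dA0 + (A0 *m M - M *m A0)) = 0 by [].
    by move=> x x0; rewrite -curvature_laurent ?K.
  by rewrite curvature_laurent // Q0 S0 linear_term !scaler0 !addr0.
have r0 : r ord0 0 = 1 by rewrite mxE.
have eps0 : eps ord0 0 = 0 by rewrite mxE.
have rank_one := rank_one_eq0 delta r0 eps0 l_neq0.
rewrite /flow1 -/f -/g; split.
  move=> [Q /rank_one[e0 d0]].
  have aE : a = q1 + t1 - g.
    have := congr1 (fun X : 'M[C]_3 => X 0 1) Q.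
    rewrite /dAi1 /dAhat_inf1 /E /Ai1 /Ahat_inf1 /A0 /Ahat_0 ME !mx3E !mxE /=.
    move=> Q01; apply/eqP; rewrite -subr_eq0 -oppr_eq0 -Q01; apply/eqP; ring.
  have bE : b = - f.
    have := congr1 (fun X : 'M[C]_3 => X 0 (1 + 1)) Q.
    rewrite /dAi1 /dAhat_inf1 /E /Ai1 /Ahat_inf1 /A0 /Ahat_0 ME !mx3E !mxE /=.
    move=> Q02; apply/eqP; rewrite -subr_eq0 -oppr_eq0 -Q02; apply/eqP; ring.
  have e1 := congr1 (fun X : 'cV[C]_3 => X 1 0) e0.
  have e2 := congr1 (fun X : 'cV[C]_3 => X (1 + 1) 0) e0.
  have d1 := congr1 (fun X : 'rV[C]_3 => X 0 1) d0.
  have d2 := congr1 (fun X : 'rV[C]_3 => X 0 (1 + 1)) d0.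
  rewrite !mxE /= {}aE {}bE in e1 e2 d1 d2 *.
  split=> //; apply/eqP; rewrite -subr_eq0.
  - by rewrite -oppr_eq0 -d1; apply/eqP; ring.
  - by rewrite -oppr_eq0 -d2; apply/eqP; ring.
  - by rewrite -e1; apply/eqP; ring.
  - by rewrite -e2; apply/eqP; ring.
move=> [dq1E dq2E dp1E dp2E [aE bE]]; split; last (apply/rank_one; split).
- rewrite /dAi1 /dAhat_inf1 /E /Ai1 /Ahat_inf1 /A0 /Ahat_0 ME !mx3E -mx3_0.
  by apply: mx3P; rewrite ?dq1E ?dq2E ?dp1E ?dp2E ?aE ?bE ?th2E ?th3E; ring.
- apply/colP => -[[|[|[|//]]] ?]; rewrite !mxE //= ?dp1E ?dp2E ?aE ?bE; ring.
- apply/rowP => -[[|[|[|//]]] ?]; rewrite !mxE //=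
    ?dq1E ?dq2E ?dp1E ?dp2E ?aE ?bE; ring.
Qed.

End Flow.

(** * Conjugation, and the second flow by symmetry *)

Section Conj.
Context {R : realType}.
Local Notation C := (CC R).

Lemma conj_mulmx n (g h X Y : 'M[C]_n) : g *m h = 1%:M ->
  (h *m X *m g) *m (h *m Y *m g) = h *m (X *m Y) *m g.
Proof. by move=> gh; rewrite !mulmxA -(mulmxA (h *m X)) gh mulmx1. Qed.

Lemma conj_eq0 n (g h X : 'M[C]_n) : g *m h = 1%:M ->
  h *m X *m g = 0 <-> X = 0.
Proof.
move=> gh; split=> [X0|->]; last by rewrite mulmx0 mul0mx.
rewrite -[X]mul1mx -[X in _ *m X]mulmx1 -gh.
have -> : g *m h *m (X *m (g *m h)) = g *m (h *m X *m g) *m h.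
  by rewrite !mulmxA.
by rewrite X0 mulmx0 mul0mx.
Qed.

(** Splits an equality of curvatures argument by argument, without letting
unification unfold the matrices. *)
Lemma curvature_congr (Ai2 Ai1 A0 dAi1 dA0 M E : 'M[C]_3)
    (Ai2' Ai1' A0' dAi1' dA0' M' E' : 'M[C]_3) (x : C) :
  Ai2 = Ai2' -> Ai1 = Ai1' -> A0 = A0' -> dAi1 = dAi1' -> dA0 = dA0' ->
  M = M' -> E = E' ->
  curvature Ai2 Ai1 A0 dAi1 dA0 M E x =
  curvature Ai2' Ai1' A0' dAi1' dA0' M' E' x.
Proof. by do 7 move=> ->. Qed.

Lemma curvature_morph (phi : 'M[C]_3 -> 'M[C]_3)
    (phiD : forall X Y, phi (X + Y) = phi X + phi Y)
    (phiZ : forall k X, phi (k *: X) = k *: phi X)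
    (phiM : forall X Y, phi (X *m Y) = phi X *m phi Y)
    (Ai2 Ai1 A0 dAi1 dA0 M E : 'M[C]_3) (x : C) :
  phi (curvature Ai2 Ai1 A0 dAi1 dA0 M E x) =
  curvature (phi Ai2) (phi Ai1) (phi A0) (phi dAi1) (phi dA0) (phi M) (phi E) x.
Proof.
have phiN X : phi (- X) = - phi X by rewrite -scaleN1r phiZ scaleN1r.
by rewrite /curvature !(phiD, phiN, phiM, phiZ).
Qed.

Lemma curvature_conj (g h Ai2 Ai1 A0 dAi1 dA0 M E : 'M[C]_3) (x : C) :
  g *m h = 1%:M ->
  h *m curvature Ai2 Ai1 A0 dAi1 dA0 M E x *m g =
  curvature (h *m Ai2 *m g) (h *m Ai1 *m g) (h *m A0 *m g)
    (h *m dAi1 *m g) (h *m dA0 *m g) (h *m M *m g) (h *m E *m g) x.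
Proof.
move=> gh; apply: (curvature_morph (fun X => h *m X *m g)) => [X Y|k X|X Y].
- by rewrite mulmxDr mulmxDl.
- by rewrite -scalemxAr -scalemxAl.
- by rewrite conj_mulmx.
Qed.

Definition swap23 : 'M[C]_3 :=
  mx3 [:: [:: 1; 0; 0]; [:: 0; 0; 1]; [:: 0; 1; 0]].

Lemma swap23K : swap23 *m swap23 = 1%:M.
Proof. by rewrite -diag3_1 /swap23 !mx3E; apply: mx3P; ring. Qed.

(** Conjugation by [swap23] turns the curvature of the second flow into that of
the first one with the indices 1 and 2 exchanged throughout. *)
Lemma curvature_flow2 (th0 th2 th3 t1 t2 q1 p1 q2 p2 dq1 dp1 dq2 dp2 a b : C) :
  th0 != 0 -> t1 != t2 ->
  (forall x, x != 0 ->
     curvature Ahat_inf2 (Ahat_inf1 th2 th3 t1 t2 q1 p1 q2 p2)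
       (Ahat_0 th0 q1 p1 q2 p2)
       (dAhat_inf1 0 1 q1 p1 q2 p2 dq1 dp1 dq2 dp2)
       (dAhat_0 th0 q1 p1 q2 p2 dq1 dp1 dq2 dp2)
       (diag3 0 a b + Bhat2 th2 th3 t1 t2 q1 p1 q2 p2) (diag3 0 0 1) x = 0)
  <-> flow1 th0 th3 th2 t2 t1 q2 p2 q1 p1 dq2 dp2 dq1 dp1 b a.
Proof.
move=> th00 t12.
have t21 : t2 != t1 by rewrite eq_sym.
apply: iff_trans (curvature_flow1 th0 th3 th2 t2 t1 q2 p2 q1 p1 dq2 dp2 dq1 dp1
  b a th00 t21).
have swapE x : swap23 *m
    curvature Ahat_inf2 (Ahat_inf1 th2 th3 t1 t2 q1 p1 q2 p2)
       (Ahat_0 th0 q1 p1 q2 p2)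
       (dAhat_inf1 0 1 q1 p1 q2 p2 dq1 dp1 dq2 dp2)
       (dAhat_0 th0 q1 p1 q2 p2 dq1 dp1 dq2 dp2)
       (diag3 0 a b + Bhat2 th2 th3 t1 t2 q1 p1 q2 p2) (diag3 0 0 1) x *m swap23
    = curvature Ahat_inf2 (Ahat_inf1 th3 th2 t2 t1 q2 p2 q1 p1)
       (Ahat_0 th0 q2 p2 q1 p1)
       (dAhat_inf1 1 0 q2 p2 q1 p1 dq2 dp2 dq1 dp1)
       (dAhat_0 th0 q2 p2 q1 p1 dq2 dp2 dq1 dp1)
       (diag3 0 b a + Bhat1 th3 th2 t2 t1 q2 p2 q1 p1) (diag3 0 1 0) x; last first.
  split=> K x x0; have {K} := K x x0.
    by move=> K; rewrite -swapE K mulmx0 mul0mx.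
  by rewrite -swapE => /(conj_eq0 _ _ _ _ swap23K).
rewrite (curvature_conj _ _ _ _ _ _ _ _ _ _ swap23K).
by apply: curvature_congr;
  rewrite /Ahat_inf2 /Ahat_inf1 /Ahat_0 /dAhat_inf1 /dAhat_0 /Bhat1 /Bhat2 /swap23;
  rewrite !mx3E; apply: mx3P; ring.
Qed.

End Conj.

(** * Hamilton's equations in explicit form *)

Section Hamiltonians.
Context {R : realType}.
Local Notation C := (CC R).

Lemma Ht1_partials (th0 th2 th3 t1 t2 q1 p1 q2 p2 : C) :
  let f := (p1 * (q1 - q2) - th2) / (t1 - t2) in
  let g := (p2 * (q2 - q1) - th3) / (t1 - t2) in
  let h := Ht1 th0 th2 th3 t1 t2 in
  [/\ derive1 (fun y => h q1 y q2 p2) p1 =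
        p1 * q1 *+ 2 - q1 ^+ 2 - t1 * q1 + th0 + p2 * q2 + g * (q1 - q2),
      derive1 (fun y => h q1 p1 q2 y) p2 = p1 * q2 + f * (q2 - q1),
      - derive1 (fun y => h y p1 q2 p2) q1 =
        p1 * q1 *+ 2 + t1 * p1 - p1 ^+ 2 - th2 - p1 * g + p2 * f &
      - derive1 (fun y => h q1 p1 y p2) q2 = p1 * g - p2 * f - p1 * p2].
Proof.
move=> f g h; rewrite /f /g /h /Ht1 /HIV; move: (t1 - t2)^-1 => d; split.
- rewrite (derive1_quadratic (- q1 ^+ 2 - t1 * q1 + th0 + p2 * q2
    + d * (q1 - q2) * (p2 * (q2 - q1) - th3)) q1); first by ring.
  by move=> y; ring.
- rewrite (derive1_quadratic
    (p1 * q2 + d * (p1 * (q1 - q2) - th2) * (q2 - q1)) 0); first by ring.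
  by move=> y; ring.
- rewrite (derive1_quadratic (p1 ^+ 2 - t1 * p1 + th2
    + d * (p1 * (p2 * q2 - th3) + p2 * (p1 * q2 + th2)))
    (- p1 - d * p1 * p2)); first by ring.
  by move=> y; ring.
- rewrite (derive1_quadratic (p1 * p2
    + d * (p2 * (p1 * q1 - th2) + p1 * (p2 * q1 + th3)))
    (- d * p1 * p2)); first by ring.
  by move=> y; ring.
Qed.

Lemma Ht2_swap (th0 th2 th3 t1 t2 : C) :
  Ht2 th0 th2 th3 t1 t2 =
  fun q1 p1 q2 p2 => Ht1 th0 th3 th2 t2 t1 q2 p2 q1 p1.
Proof.
apply/funext => q1; apply/funext => p1; apply/funext => q2; apply/funext => p2.
by rewrite /Ht1 /Ht2 /HIV; ring.
Qed.

Lemma gauge_eqs (th2 th3 t1 t2 q1 p1 q2 p2 a b : C) : t1 != t2 ->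
  ((t1 - t2) * a = p2 * (q1 - q2) + (t1 - t2) * (q1 + t1) + th3 /\
   (t1 - t2) * b = p1 * (q2 - q1) + th2) <->
  (a = q1 + t1 - (p2 * (q2 - q1) - th3) / (t1 - t2) /\
   b = - ((p1 * (q1 - q2) - th2) / (t1 - t2))).
Proof.
rewrite -subr_eq0 => t12.
have -> : p2 * (q1 - q2) + (t1 - t2) * (q1 + t1) + th3 =
    (t1 - t2) * (q1 + t1 - (p2 * (q2 - q1) - th3) / (t1 - t2)) by field.
have -> : p1 * (q2 - q1) + th2 =
    (t1 - t2) * - ((p1 * (q1 - q2) - th2) / (t1 - t2)) by field.
by split=> -[] => [/(mulfI t12) -> /(mulfI t12) ->|-> ->].
Qed.

Lemma hamilton_flow1 (th0 th2 th3 : C) (q1 p1 q2 p2 : C * C -> C) (t e : C * C)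
    (a b : C) : t.1 != t.2 ->
  (hamilton_at e (Ht1 th0 th2 th3) q1 p1 q2 p2 t /\
   ((t.1 - t.2) * a
      = p2 t * (q1 t - q2 t) + (t.1 - t.2) * (q1 t + t.1) + th3 /\
    (t.1 - t.2) * b = p1 t * (q2 t - q1 t) + th2)) <->
  flow1 th0 th2 th3 t.1 t.2 (q1 t) (p1 t) (q2 t) (p2 t)
    ('D_e q1 t) ('D_e p1 t) ('D_e q2 t) ('D_e p2 t) a b.
Proof.
move=> t12; have := gauge_eqs th2 th3 _ _ (q1 t) (p1 t) (q2 t) (p2 t) a b t12.
have := Ht1_partials th0 th2 th3 t.1 t.2 (q1 t) (p1 t) (q2 t) (p2 t).
move=> [dp1 dp2 dq1 dq2] G; split.
  move=> [[h1 h2 h3 h4] /G ab]; split; last exact: ab.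
  - exact: etrans h1 dp1.
  - exact: etrans h2 dp2.
  - exact: etrans h3 dq1.
  - exact: etrans h4 dq2.
move=> [h1 h2 h3 h4 /G ab]; split; last exact: ab.
split.
- exact: etrans h1 (esym dp1).
- exact: etrans h2 (esym dp2).
- exact: etrans h3 (esym dq1).
- exact: etrans h4 (esym dq2).
Qed.

(** The roles of u and v, like the indices, are exchanged for the second time. *)
Lemma hamilton_flow2 (th0 th2 th3 : C) (q1 p1 q2 p2 : C * C -> C) (t e : C * C)
    (a b : C) : t.1 != t.2 ->
  [/\ hamilton_at e (Ht2 th0 th2 th3) q1 p1 q2 p2 t,
      (t.2 - t.1) * a = p2 t * (q1 t - q2 t) + th3 &
      (t.2 - t.1) * b
        = p1 t * (q2 t - q1 t) + (t.2 - t.1) * (q2 t + t.2) + th2] <->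
  flow1 th0 th3 th2 t.2 t.1 (q2 t) (p2 t) (q1 t) (p1 t)
    ('D_e q2 t) ('D_e p2 t) ('D_e q1 t) ('D_e p1 t) b a.
Proof.
rewrite eq_sym => t21.
have := gauge_eqs th3 th2 _ _ (q2 t) (p2 t) (q1 t) (p1 t) b a t21.
have := Ht1_partials th0 th3 th2 t.2 t.1 (q2 t) (p2 t) (q1 t) (p1 t).
rewrite /hamilton_at Ht2_swap => -[dp2 dp1 dq2 dq1] G; split.
  move=> [[h1 h2 h3 h4] ua vb]; split; last exact: (G.1 (conj vb ua)).
  - exact: etrans h2 dp2.
  - exact: etrans h1 dp1.
  - exact: etrans h4 dq2.
  - exact: etrans h3 dq1.
move=> [h2 h1 h4 h3 /G[vb ua]]; split; [split|exact: ua|exact: vb].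
- exact: etrans h1 (esym dp1).
- exact: etrans h2 (esym dp2).
- exact: etrans h3 (esym dq1).
- exact: etrans h4 (esym dq2).
Qed.
End Hamiltonians.
Arguments hamilton_flow1 {R th0 th2 th3 q1 p1 q2 p2 t e a b}.
Arguments hamilton_flow2 {R th0 th2 th3 q1 p1 q2 p2 t e a b}.

(** * Removing the gauge *)

Section Gauge.
Context {R : realType}.
Local Notation C := (CC R).
Implicit Types (t e : C * C).

Lemma diag3_mul (a b c a' b' c' : C) :
  diag3 a b c *m diag3 a' b' c' = diag3 (a * a') (b * b') (c * c').
Proof. by rewrite !mx3E; apply: mx3P; ring. Qed.

Lemma gaugeG_mulV (u v : C) : u != 0 -> v != 0 ->
  gaugeG u v *m gaugeG u^-1 v^-1 = 1%:M.
Proof. by move=> u0 v0; rewrite diag3_mul mulr1 !mulfV // diag3_1. Qed.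

Lemma invmx_gaugeG (u v : C) : u != 0 -> v != 0 ->
  invmx (gaugeG u v) = gaugeG u^-1 v^-1.
Proof.
move=> u0 v0; have GV := gaugeG_mulV u v u0 v0.
have [Gu _] := mulmx1_unit GV.
by rewrite -[LHS]mulmx1 -GV mulmxA mulVmx // mul1mx.
Qed.

Lemma is_derive_diag3 (a b c : C * C -> C) t e da db dc :
  is_derive t e a da -> is_derive t e b db -> is_derive t e c dc ->
  is_derive t e (fun s => diag3 (a s) (b s) (c s)) (diag3 da db dc).
Proof.
move=> ad bd cd; rewrite diag3E.
rewrite (_ : (fun s => _) = fun s => mx3 [:: [:: a s; 0; 0]; [:: 0; b s; 0];
  [:: 0; 0; c s]]); last by apply/funext => s; rewrite diag3E.
by apply: is_derive_matrix => -[[|[|[|//]]] ?] [[|[|[|//]]] ?] //=;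
  exact: is_derive_cst.
Qed.

Lemma is_derive_fst t e : is_derive t e (fun s => s.1) e.1.
Proof. by apply: is_derive_affine => h; rewrite /= addrC. Qed.

Lemma is_derive_snd t e : is_derive t e (fun s => s.2) e.2.
Proof. by apply: is_derive_affine => h; rewrite /= addrC. Qed.

Section System.
Variables (th0 th2 th3 : C) (q1 p1 q2 p2 u v : C * C -> C) (t e : C * C).
Variables (dq1 dp1 dq2 dp2 du dv : C).
Hypotheses (q1d : is_derive t e q1 dq1) (p1d : is_derive t e p1 dp1).
Hypotheses (q2d : is_derive t e q2 dq2) (p2d : is_derive t e p2 dp2).
Hypotheses (ud : is_derive t e u du) (vd : is_derive t e v dv).
(* The explicit inverse of G is differentiated, so it must be valid near t. *)
Hypothesis uv_neq0 : \forall s \near t, (u s != 0) /\ (v s != 0).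

Let cstd (c : C) : is_derive t e (fun=> c) 0 := is_derive_cst c t e.

Lemma is_derive_Ahat_inf1 : is_derive t e
  (fun s => Ahat_inf1 th2 th3 s.1 s.2 (q1 s) (p1 s) (q2 s) (p2 s))
  (dAhat_inf1 e.1 e.2 (q1 t) (p1 t) (q2 t) (p2 t) dq1 dp1 dq2 dp2).
Proof.
have lower (q p : C * C -> C) (dq dp th : C) : is_derive t e q dq -> is_derive t e p dp ->
    is_derive t e (fun s => - p s * q s + th) (- (dp * q t + p t * dq)).
  move=> qd pd.
  apply: is_derive_eq (is_deriveDf (is_deriveMf (is_deriveNf pd) qd) (cstd th)) _.
  by ring.
apply: is_derive_matrix => -[[|[|[|//]]] ?] [[|[|[|//]]] ?] //=;
  do ?[exact: cstd|exact: lower].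
- exact: is_deriveNf (is_derive_fst t e).
- exact: is_deriveNf (is_derive_snd t e).
Qed.

Lemma is_derive_Ahat_0 : is_derive t e
  (fun s => Ahat_0 th0 (q1 s) (p1 s) (q2 s) (p2 s))
  (dAhat_0 th0 (q1 t) (p1 t) (q2 t) (p2 t) dq1 dp1 dq2 dp2).
Proof.
apply: is_derive_mulmx.
  by apply: is_derive_matrix => -[[|[|[|//]]] ?] _ //=; exact: cstd.
apply: is_derive_matrix => _ [[|[|[|//]]] ?] /=.
- apply: is_derive_eq (is_deriveDf (is_deriveDf (is_deriveMf p1d q1d)
    (is_deriveMf p2d q2d)) (cstd th0)) _.
  by rewrite addr0.
- exact: is_deriveNf.
- exact: is_deriveNf.
Qed.

(** With G' = W G and (G^-1)' = - G^-1 W, the derivative of the gauged A is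
G^-1 (A' + [A, W]) G, and E commutes with G, so the compatibility condition is
G^-1 (curvature) G = 0. *)
Lemma compatible_at_curvature (Bhat : C * C -> 'M[C]_3) (e2 e3 x : C) :
  let G s := gaugeG (u s) (v s) in
  let E := diag3 0 e2 e3 in
  compatible_at e (Amx th0 th2 th3 q1 p1 q2 p2 u v)
    (fun y s => - (y *: E) + invmx (G s) *m Bhat s *m G s) x t <->
  curvature Ahat_inf2 (Ahat_inf1 th2 th3 t.1 t.2 (q1 t) (p1 t) (q2 t) (p2 t))
    (Ahat_0 th0 (q1 t) (p1 t) (q2 t) (p2 t))
    (dAhat_inf1 e.1 e.2 (q1 t) (p1 t) (q2 t) (p2 t) dq1 dp1 dq2 dp2)
    (dAhat_0 th0 (q1 t) (p1 t) (q2 t) (p2 t) dq1 dp1 dq2 dp2)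
    (diag3 0 ((u t)^-1 * du) ((v t)^-1 * dv) + Bhat t) E x = 0.
Proof.
move=> G E; have [ut0 vt0] := nbhs_singleton uv_neq0.
pose Gi s := gaugeG (u s)^-1 (v s)^-1.
pose W := diag3 0 ((u t)^-1 * du) ((v t)^-1 * dv).
pose hA s := x *: Ahat_inf2 + Ahat_inf1 th2 th3 s.1 s.2 (q1 s) (p1 s) (q2 s) (p2 s)
  + x^-1 *: Ahat_0 th0 (q1 s) (p1 s) (q2 s) (p2 s).
pose dA := dAhat_inf1 e.1 e.2 (q1 t) (p1 t) (q2 t) (p2 t) dq1 dp1 dq2 dp2
  + x^-1 *: dAhat_0 th0 (q1 t) (p1 t) (q2 t) (p2 t) dq1 dp1 dq2 dp2.
have GGi : G t *m Gi t = 1%:M by exact: gaugeG_mulV.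
have GiG : Gi t *m G t = 1%:M by exact: mulmx1C.
have hAd : is_derive t e hA dA.
  rewrite -[dA]add0r addrA.
  exact: is_deriveD (is_deriveD (is_derive_cst (x *: Ahat_inf2) t e)
    is_derive_Ahat_inf1) (is_deriveZ x^-1 is_derive_Ahat_0).
have Gd : is_derive t e G (W *m G t).
  rewrite (_ : W *m G t = diag3 0 du dv); last first.
    by rewrite diag3_mul mul0r; congr diag3; rewrite mulrC mulVKf.
  exact: (is_derive_diag3 (fun=> 1) u v t e 0 du dv).
have Gid : is_derive t e Gi (- (Gi t *m W)).
  rewrite (_ : - _ = diag3 0 (- (u t) ^- 2 * du) (- (v t) ^- 2 * dv)).
    exact: (is_derive_diag3 (fun=> 1) _ _ t e 0 _ _ _
      (is_deriveVf ut0 ud) (is_deriveVf vt0 vd)).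
  rewrite /Gi /W /gaugeG !mx3E; apply: mx3P; field; rewrite ?ut0 ?vt0 //.
have Ad : is_derive t e (Amx th0 th2 th3 q1 p1 q2 p2 u v x)
    (Gi t *m (dA + (hA t *m W - W *m hA t)) *m G t).
  apply: (near_eq_is_derive (f := fun s => Gi s *m hA s *m G s)).
    apply: filterS uv_neq0 => s [us0 vs0].
    by rewrite /Amx invmx_gaugeG.
  apply: is_derive_eq (is_derive_mulmx (is_derive_mulmx Gid hAd) Gd) _.
  move: (hA t) (dA) => X dX; rewrite !(mulmxDr, mulmxDl, mulmxN, mulNmx) !mulmxA.
  by rewrite [- _ + _]addrC -addrA [- _ + _]addrC.
have EE : Gi t *m E *m G t = E.
  rewrite !diag3_mul; congr diag3; first by rewrite mulr0 mul0r.
  - by rewrite mulrAC mulVf // mul1r.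
  - by rewrite mulrAC mulVf // mul1r.
have BE : - (x *: E) + Gi t *m Bhat t *m G t =
    Gi t *m (Bhat t - x *: E) *m G t.
  by rewrite mulmxDr mulmxDl mulmxN mulNmx -scalemxAr -scalemxAl EE addrC.
have dB : derive1 (fun y => - (y *: E) + invmx (G t) *m Bhat t *m G t) x = - E.
  rewrite derive1E.
  have yd : is_derive x (1 : C) (fun y => y) 1 by exact: is_derive_id.
  have [_ ->] := is_deriveD (is_deriveN (is_derive_scalel E yd))
    (is_derive_cst (invmx (G t) *m Bhat t *m G t) x 1).
  by rewrite scale1r addr0.
set K := curvature _ _ _ _ _ _ _ _.
have KE : K = dA + (hA t *m W - W *m hA t) + E
    + (hA t *m (Bhat t - x *: E) - (Bhat t - x *: E) *m hA t).
  rewrite /K /curvature -/dA -/(hA t) -/W -(addrA W).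
  move: (hA t) (dA) (Bhat t - x *: E) => X dX B; rewrite mulmxDr mulmxDl.
  move: (X *m W) (W *m X) (X *m B) (B *m X) => XW WX XB BX.
  by rewrite opprD [XW + XB + _]addrACA [dX + _ + E]addrAC -!addrA.
apply: iff_trans (conj_eq0 _ _ _ K GGi).
have AE : 'D_e (fun s => Amx th0 th2 th3 q1 p1 q2 p2 u v x s) t =
    Gi t *m (dA + (hA t *m W - W *m hA t)) *m G t by case: Ad.
have AtE : Amx th0 th2 th3 q1 p1 q2 p2 u v x t = Gi t *m hA t *m G t.
  by rewrite /Amx (invmx_gaugeG _ _ ut0 vt0).
rewrite /compatible_at AE dB AtE (invmx_gaugeG _ _ ut0 vt0) BE [- - E]opprK.
move: (hA t) (dA) (Bhat t - x *: E) KE => X dX B KE.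
rewrite (conj_mulmx _ _ _ X B GGi) (conj_mulmx _ _ _ B X GGi) KE.
have conjB Y Z : Gi t *m (Y - Z) *m G t = Gi t *m Y *m G t - Gi t *m Z *m G t.
  by rewrite mulmxBr mulmxBl.
have conjD Y Z : Gi t *m (Y + Z) *m G t = Gi t *m Y *m G t + Gi t *m Z *m G t.
  by rewrite mulmxDr mulmxDl.
move: (X *m W - W *m X) (X *m B) (B *m X) => XW XB BX.
by rewrite (conjD (dX + XW + E)) (conjD (dX + XW)) (conjB XB) EE.
Qed.
End System.
End Gauge.

(** * The equivalence *)

Theorem mainTheorem12 (R : realType) (th0 thi1 thi2 thi3 : CC R)
    (fuchs : th0 + thi1 + thi2 + thi3 = 0) (th0_neq0 : th0 != 0)
    (D : set (CC R * CC R)) (domD : domain D)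
    (offdiag : forall t, D t -> t.1 != t.2)
    (q1 p1 q2 p2 u v : CC R * CC R -> CC R)
    (hq1 : holomorphic_on D q1) (hp1 : holomorphic_on D p1)
    (hq2 : holomorphic_on D q2) (hp2 : holomorphic_on D p2)
    (hu : holomorphic_on D u) (hv : holomorphic_on D v)
    (u_neq0 : forall t, D t -> u t != 0)
    (v_neq0 : forall t, D t -> v t != 0) :
  let A := Amx th0 thi2 thi3 q1 p1 q2 p2 u v in
  let B1 := Bmx1 thi2 thi3 q1 p1 q2 p2 u v in
  let B2 := Bmx2 thi2 thi3 q1 p1 q2 p2 u v in
  (forall t, D t -> forall x : CC R, x != 0 ->
     compatible_at dt1 A B1 x t /\ compatible_at dt2 A B2 x t)
  <->
  (forall t, D t ->
     [/\ hamilton_at dt1 (Ht1 th0 thi2 thi3) q1 p1 q2 p2 t,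
         hamilton_at dt2 (Ht2 th0 thi2 thi3) q1 p1 q2 p2 t,
         (t.1 - t.2) * ((u t)^-1 * 'D_dt1 u t)
           = p2 t * (q1 t - q2 t) + (t.1 - t.2) * (q1 t + t.1) + thi3 /\
         (t.1 - t.2) * ((v t)^-1 * 'D_dt1 v t)
           = p1 t * (q2 t - q1 t) + thi2,
         (t.2 - t.1) * ((u t)^-1 * 'D_dt2 u t)
           = p2 t * (q1 t - q2 t) + thi3 &
         (t.2 - t.1) * ((v t)^-1 * 'D_dt2 v t)
           = p1 t * (q2 t - q1 t) + (t.2 - t.1) * (q2 t + t.2) + thi2]).
Proof.
move=> A B1 B2.
have der f e t : holomorphic_on D f -> D t -> is_derive t e f ('D_e f t).
  by move=> fD Dt; apply/derivableP/diff_derivable/fD.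
have uv_near t : D t -> \forall s \near t, (u s != 0) /\ (v s != 0).
  move=> Dt; have [_ Dopen _] := domD.
  apply: filterS (open_nbhs_nbhs (conj Dopen Dt)) => s Ds.
  by split; [exact: u_neq0|exact: v_neq0].
have curv t e Dt := compatible_at_curvature th0 thi2 thi3 _ _ _ _ _ _ t e _ _ _ _ _ _
  (der _ e t hq1 Dt) (der _ e t hp1 Dt) (der _ e t hq2 Dt) (der _ e t hp2 Dt)
  (der _ e t hu Dt) (der _ e t hv Dt) (uv_near t Dt).
(* Both sides are pointwise in t, so the equivalence is proved at each point. *)
suff main t (Dt : D t) : (forall x : CC R, x != 0 ->
     compatible_at dt1 A B1 x t /\ compatible_at dt2 A B2 x t) <->
   (flow1 th0 thi2 thi3 t.1 t.2 (q1 t) (p1 t) (q2 t) (p2 t)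
      ('D_dt1 q1 t) ('D_dt1 p1 t) ('D_dt1 q2 t) ('D_dt1 p2 t)
      ((u t)^-1 * 'D_dt1 u t) ((v t)^-1 * 'D_dt1 v t) /\
    flow1 th0 thi3 thi2 t.2 t.1 (q2 t) (p2 t) (q1 t) (p1 t)
      ('D_dt2 q2 t) ('D_dt2 p2 t) ('D_dt2 q1 t) ('D_dt2 p1 t)
      ((v t)^-1 * 'D_dt2 v t) ((u t)^-1 * 'D_dt2 u t)).
  split=> [K t Dt|K t Dt]; have t12 := offdiag t Dt.
    have [] := (main t Dt).1 (K t Dt).
    by move=> /(hamilton_flow1 t12)[? ?]
      /(hamilton_flow2 t12)[].
  have [h1 h2 uv1 u2 v2] := K t Dt; apply/(main t Dt); split.
    exact/(hamilton_flow1 t12).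
  exact/(hamilton_flow2 t12).
have t12 := offdiag t Dt.
have F1 := curvature_flow1 th0 thi2 thi3 _ _ (q1 t) (p1 t) (q2 t) (p2 t)
  ('D_dt1 q1 t) ('D_dt1 p1 t) ('D_dt1 q2 t) ('D_dt1 p2 t)
  ((u t)^-1 * 'D_dt1 u t) ((v t)^-1 * 'D_dt1 v t) th0_neq0 t12.
have F2 := curvature_flow2 th0 thi2 thi3 _ _ (q1 t) (p1 t) (q2 t) (p2 t)
  ('D_dt2 q1 t) ('D_dt2 p1 t) ('D_dt2 q2 t) ('D_dt2 p2 t)
  ((u t)^-1 * 'D_dt2 u t) ((v t)^-1 * 'D_dt2 v t) th0_neq0 t12.
have C1 := curv t dt1 Dt
  (fun s => Bhat1 thi2 thi3 s.1 s.2 (q1 s) (p1 s) (q2 s) (p2 s)) 1 0.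
have C2 := curv t dt2 Dt
  (fun s => Bhat2 thi2 thi3 s.1 s.2 (q1 s) (p1 s) (q2 s) (p2 s)) 0 1.
split=> [K|[/F1 K1 /F2 K2] x x0].
  split; [apply/F1|apply/F2] => x x0; have [c1 c2] := K x x0.
    exact: ((C1 x).1 c1).
  exact: ((C2 x).1 c2).
split; [exact: ((C1 x).2 (K1 x x0))|exact: ((C2 x).2 (K2 x x0))].
Qed.
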